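(* Let $L>0$. Consider the two-step variable step-size linear multistep methods $$x_{n+2}+a_nx_{n+1}+b_nx_n=h_{n+1}\big(c_n\,g(x_{n+1})-d_n\,g(x_n)\big)$$ applied to the gradient flow ($g=-\nabla f$, $f$ convex and $L$-smooth), with step sizes $h_n=an+(1+r)a>0$, where $a>0$ and $r$ are real constants, and with $b_n=\frac{\xi_n}{\xi_{n+1}+r}$ where $\xi_n=n$. Suppose that the method is consistent of order $1$, zero-stable and absolutely stable, and that it satisfies the convergence rate $O(1/n^2)$ ensured by the Lyapunov conditions (L) (all these notions are defined in the context). Then, among all such methods (i.e. all admissible parameters $a$, $r$, $(c_n)_{n\ge0}$, which determine $a_n,b_n,d_n$), the parameters that minimize the coefficient of $1/n^2$ in $r^2/B_n$ (that is, $\lim_{n\to\infty}n^2r^2/B_n$) are those of Nesterov's accelerated gradient method NAG-c, namely $$r=2,\qquad a=\frac1{4L},\qquad b_n=\frac{n}{n+3},\qquad c_n=\frac{8n+12}{(n+3)(n+4)},\qquad d_n=\frac{4n}{(n+3)(n+4)}.$$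
   Context: Write $w_{n}=h_{n}/h_{n-1}$; indices $n$ range over integers $\ge 0$. ''$L$-smooth'' means differentiable with $L$-Lipschitz gradient. Consistency of order $1$ means $a_n=-b_n-1$ and $d_n=c_n+\frac{b_n}{w_{n+1}}-1$ for all $n$. Zero-stability means: there is $M>0$ with $\|A_{n+l}\cdots A_{n+1}A_n\|\le M$ for all $n,l\ge0$, where $A_n=\begin{bmatrix}-a_n&-b_n\\1&0\end{bmatrix}$. Under consistency this is equivalent to: $\left|\prod_{i=n}^{n+l}b_i\right|$ and $\left|\sum_{j=n}^{n+l}\prod_{i=n}^{j-1}(-b_i)\right|$ are bounded uniformly over $n,l\ge0$. Absolute stability (for Dahlquist's test equation $\dot x=\lambda x$, with $\lambda$ ranging over $[-L,0)$, the possible nonzero eigenvalues of $-\nabla^2 f$) means: with $\mu_n=\lambda(h_{n+1}-h_n)$, the sequences $\mu_n$, $a_n$, $b_n$, $\frac{w_{n+1}}{w_{n+1}-1}c_n$, $\frac{w_{n+1}}{w_{n+1}-1}d_n$ converge, to limits $\mu$, $\alpha_1$, $\alpha_0$, $\widehat c$, $\widehat d$ respectively, and all roots of $z^2+(\alpha_1-\mu\widehat c)z+(\alpha_0+\mu\widehat d)$ have modulus $<1$. Under consistency of order $1$ this means that the limits exist, $b_n\to1$, $0<\widehat d<\widehat c$ and $-\frac{4}{\widehat c+\widehat d}<\mu<0$ (here $\mu=\lambda a$). Lyapunov conditions (L): put $$A_{n+1}=h_{n+1}(\xi_{n+1}+r)c_n-h_{n+2}(\xi_{n+2}+r)d_{n+1},\qquad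 B_n=A_{n+1}\xi_n .$$ The initial parameters satisfy $\xi_0=0$, $d_0=0$ (and the iteration is started with $x_1=x_0$), and for all $n\ge0$: $$B_n\ge0,\qquad B_{n+1}-B_n\ge0,\qquad B_{n+1}-B_n-rA_{n+1}\le0,$$ $$\frac{A_{n+1}}2-\frac r{2L}-h_{n+1}(\xi_{n+1}+r)d_n+\frac{A_{n+1}h_{n+1}^2(\xi_{n+1}+r)^2d_n^2L}{2B_n}\le0,$$ where for $n=0$ the last fraction is understood as $0$ because $d_0=0$. These conditions yield $f(x_n)-f(x^* )\le\frac{r^2}{2B_n}\|x_1-x^*\|^2$ for a minimizer $x^*$ of $f$ whenever $B_n>0$; the method satisfies the convergence rate $O(1/n^2)$ ensured by (L) if (L) holds and $B_n=\Theta(n^2)$. NAG-c is the iteration $y_{n+1}=x_n-s\nabla f(x_n)$, $x_{n+1}=y_{n+1}+\frac{n-1}{n+2}(y_{n+1}-y_n)$ (here with $s=1/L$).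
   Formalization: Zero-stability is taken as uniform bounds on |∏b_i| and |∑∏(-b_i)|, not on the matrix products A_{n+l}⋯A_n: the two are not equivalent, and as b_n→1 the matrix bound fails for every method of the family, NAG-c included. *)

(* Defs.v *)
From HB Require Import structures.
From mathcomp Require Import all_boot all_order all_algebra.
From mathcomp Require Import complex.
From mathcomp Require Import all_classical all_reals all_analysis.
Import Order.TTheory GRing.Theory Num.Theory.
Import numFieldNormedType.Exports.
Set Implicit Arguments.
Unset Strict Implicit.
Unset Printing Implicit Defensive.
Local Open Scope classical_set_scope.
Local Open Scope ring_scope.

(* The data of the two-step variable step-size method
     x_{n+2} + a_n x_{n+1} + b_n x_n
       = h_{n+1} (c_n g(x_{n+1}) - d_n g(x_n)),
   with step m n = h_n, coefa m n = a_n, ..., coefd m n = d_n. *)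
Record lmm (R : realType) := Lmm {
  step : nat -> R;
  coefa : nat -> R;
  coefb : nat -> R;
  coefc : nat -> R;
  coefd : nat -> R }.

Definition lmm_iteration (R : realType) (V : lmodType R) (m : lmm R)
    (g : V -> V) (x : nat -> V) : Prop :=
  forall n, x n.+2 + coefa m n *: x n.+1 + coefb m n *: x n =
    step m n.+1 *: (coefc m n *: g (x n.+1) - coefd m n *: g (x n)).

(* w_n = h_n / h_{n-1}; only used at indices n >= 1. *)
Definition step_ratio (R : realType) (m : lmm R) (n : nat) : R :=
  step m n / step m n.-1.

Definition consistent (R : realType) (m : lmm R) : Prop :=
  forall n, coefa m n = - coefb m n - 1 /\
    coefd m n = coefc m n + coefb m n / step_ratio m n.+1 - 1.

(* Zero-stability of a consistent method, stated through the coefficients: the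
   products of the b_i and the sums of products of the - b_i are uniformly
   bounded. This is not equivalent to a uniform bound on the products of the
   companion matrices [[- a_n, - b_n], [1, 0]]: for a_n = - b_n - 1 the entries
   of these products contain the sums of products of the b_i (without sign),
   which are unbounded as soon as b_n --> 1. The matrix bound thus fails for
   every absolutely stable consistent method, NAG-c included. *)
Definition zero_stable (R : realType) (m : lmm R) : Prop :=
  exists2 M : R, 0 < M & forall n l : nat,
    `| \prod_(n <= i < (n + l).+1) coefb m i | <= M /\
    `| \sum_(n <= j < (n + l).+1) \prod_(n <= i < j) (- coefb m i) | <= M.

Definition absolutely_stable (R : realType) (L : R) (m : lmm R) : Prop :=
  forall lambda : R, - L <= lambda -> lambda < 0 ->
  exists mu alpha1 alpha0 chat dhat : R,
  [/\ (fun n => lambda * (step m n.+1 - step m n)) @ \oo --> mu,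
      coefa m @ \oo --> alpha1,
      coefb m @ \oo --> alpha0,
      (fun n => step_ratio m n.+1 / (step_ratio m n.+1 - 1) * coefc m n)
        @ \oo --> chat
    & (fun n => step_ratio m n.+1 / (step_ratio m n.+1 - 1) * coefd m n)
        @ \oo --> dhat] /\
  forall z : R[i],
    z ^+ 2 + (alpha1 - mu * chat)%:C%C * z + (alpha0 + mu * dhat)%:C%C = 0 ->
    `|z| < 1.

(* lyapAS n is A_{n+1}, so that lyapB n = B_n = A_{n+1} xi_n. *)
Definition lyapAS (R : realType) (r : R) (xi : nat -> R) (m : lmm R)
    (n : nat) : R :=
  step m n.+1 * (xi n.+1 + r) * coefc m n
  - step m n.+2 * (xi n.+2 + r) * coefd m n.+1.

Definition lyapB (R : realType) (r : R) (xi : nat -> R) (m : lmm R)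
    (n : nat) : R := lyapAS r xi m n * xi n.

(* The quotient by B_n uses x / 0 = 0. At n = 0 it vanishes, as it should,
   since d_0 = 0. At n >= 1, when xi_n = n and B_n = Theta(n^2), no division
   by 0 occurs: B_n = 0 gives A_{n+1} = 0, and then the first and third
   conditions give B_{n+1} = 0, hence B_k = 0 for all k >= n. *)
Definition lyapunov (R : realType) (L r : R) (xi : nat -> R) (m : lmm R)
    : Prop :=
  [/\ xi 0%N = 0, coefd m 0%N = 0 &
  forall n,
  [/\ 0 <= lyapB r xi m n,
      0 <= lyapB r xi m n.+1 - lyapB r xi m n,
      lyapB r xi m n.+1 - lyapB r xi m n - r * lyapAS r xi m n <= 0
    & lyapAS r xi m n / 2 - r / (2 * L)
      - step m n.+1 * (xi n.+1 + r) * coefd m n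
      + lyapAS r xi m n * step m n.+1 ^+ 2 * (xi n.+1 + r) ^+ 2
          * coefd m n ^+ 2 * L / (2 * lyapB r xi m n) <= 0]].

Definition lyapunov_rate (R : realType) (L r : R) (xi : nat -> R) (m : lmm R)
    : Prop :=
  lyapunov L r xi m /\
  lyapB r xi m \is 'Theta_\oo (fun n : nat => n%:R ^+ 2 : R).

Definition linear_xi (R : realType) (n : nat) : R := n%:R.

Definition admissible (R : realType) (L a r : R) (m : lmm R) : Prop :=
  [/\ 0 < a,
      forall n, step m n = a * n%:R + (1 + r) * a /\ 0 < step m n &
      forall n, coefb m n = linear_xi R n / (linear_xi R n.+1 + r)] /\
  [/\ consistent m, zero_stable m, absolutely_stable L m
    & lyapunov_rate L r (@linear_xi R) m].

(* Its limit is the coefficient of 1/n^2 in r^2 / B_n. *)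
Definition rate_seq (R : realType) (r : R) (m : lmm R) (n : nat) : R :=
  n%:R ^+ 2 * (r ^+ 2 / lyapB r (@linear_xi R) m n).

Definition minimizer (R : realType) (L a r : R) (m : lmm R) : Prop :=
  admissible L a r m /\
  forall (a' r' : R) (m' : lmm R), admissible L a' r' m' ->
    limn (rate_seq r m) <= limn (rate_seq r' m').

(* df plays the role of the gradient of f. Since y_0 only enters through x_1,
   requiring that some y exists leaves both x_0 and x_1 free. *)
Definition nag_c (R : realType) (V : lmodType R) (s : R) (df : V -> V)
    (x y : nat -> V) : Prop :=
  forall n, y n.+1 = x n - s *: df (x n) /\
    x n.+1 = y n.+1 + ((n%:R - 1) / (n%:R + 2)) *: (y n.+1 - y n).

(* Main.v *)
Require Import Defs.
From mathcomp Require Import all_boot all_order all_algebra.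
From mathcomp Require Import all_classical all_reals all_analysis.
From mathcomp Require Import complex ring lra.
Set Implicit Arguments.
Unset Strict Implicit.
Unset Printing Implicit Defensive.
Import Order.TTheory GRing.Theory Num.Theory.
Import numFieldNormedType.Exports.
Local Open Scope classical_set_scope.
Local Open Scope ring_scope.

(* With D_n = (n + 2 + r) d_n, consistency gives
     A_{n+1} = a ((n + 1 + r) (D_n + 2 + r) - (n + 2 + r) D_{n+1}),
   and absolute stability makes D_n converge, so that A_{n+1} / n tends to
   a (2 + r) and the rate coefficient is r^2 / (a (2 + r)). The third Lyapunov
   condition forces r >= 2, and the limit of the fourth one divided by n,
     2 + r - 2 D + a L D^2 <= 0   with D = lim D_n,
   forces a L (2 + r) <= 1. The coefficient is thus at least L r^2 >= 4 L, with
   equality only for r = 2 and a = 1 / (4 L). For these parameters the fourth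
   condition leaves a single sequence D_n, that of NAG-c: any deviation from it
   would satisfy a discrete Riccati inequality and blow up. *)

(** * Divergence of the harmonic series, and limits of sequences affine in [1/(n+1)] *)

Lemma harmonic_descent (R : realType) (u : nat -> R) (k : R) (N : nat) :
  0 < k -> (forall n, (N <= n)%N -> 0 <= u n) ->
  ~ (forall n, (N <= n)%N -> k / n.+1%:R <= u n - u n.+1).
Proof.
move=> k0 u0 du; apply: (@dvg_harmonic R).
(* The decreases telescope: the harmonic tail past [N] is at most [(u N - u (N + n)) / k], hence at
   most [u N / k], so the harmonic series would converge. *)
have bnd n : series harmonic (N + n)%N <= series harmonic N + (u N - u (N + n)%N) / k.
  elim: n => [|n IH]; first by rewrite addn0 subrr mul0r addr0.
  rewrite addnS seriesEnat /= big_nat_recr //=.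
  have := du (N + n)%N (leq_addr _ _).
  rewrite mulrC -ler_pdivlMr // => H.
  move: IH; rewrite seriesEnat /= => IH.
  apply: (le_trans (lerD IH H)).
  by rewrite -addrA -mulrDl addrA subrK.
have hmono : nondecreasing_seq (series (@harmonic R)).
  apply/nondecreasing_seqP => j.
  by rewrite !seriesEnat /= big_nat_recr //= lerDl invr_ge0.
apply: nondecreasing_is_cvgn => //.
exists (series harmonic N + u N / k) => _ [n _ <-].
have bN j : series harmonic (N + j)%N <= series harmonic N + u N / k.
  apply: le_trans (bnd j) _.
  rewrite lerD2l ler_pM2r ?invr_gt0 // gerBl u0 ?leq_addr //.
case: (leqP N n) => [Nn|nN]; first by rewrite -(subnKC Nn).
apply: le_trans (bN 0%N); rewrite addn0.
exact/hmono/ltnW.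
Qed.

Lemma cvg_affine_harmonic (R : realType) (c k : R) :
  c + k * harmonic n @[n --> \oo] --> c.
Proof.
rewrite -[X in _ --> X]addr0 -(mulr0 k).
by apply: cvgD; [exact: cvg_cst|apply: cvgMr; exact: cvg_harmonic].
Qed.

Lemma cvg_homographic (R : realType) (u : nat -> R) (c k : R) (j : nat) :
  (forall n, u n = c + k / (n%:R + j.+1%:R)) -> u @ \oo --> c.
Proof.
move=> uE.
rewrite (_ : u = (fun n => c + k * harmonic (n + j)%N)); last first.
  by apply/funext => n /=; rewrite uE -natrD addnS.
rewrite (cvg_shiftn j (fun n => c + k * harmonic n)).
exact: cvg_affine_harmonic.
Qed.

(** * The sequence [D_n = (n + 2 + r) d_n] and the limit of the rate coefficient *)

Definition scaledD (R : realType) (r : R) (m : lmm R) (n : nat) : R :=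
  (n%:R + 2 + r) * coefd m n.

Lemma admissible_r (R : realType) (L a r : R) (m : lmm R) :
  admissible L a r m -> -1 < r.
Proof.
move=> [[a0 /(_ 0%N) [-> h] _] _].
by move: h; rewrite mulr0 add0r pmulr_lgt0 //; lra.
Qed.

Lemma admissible_step_ratio (R : realType) (L a r : R) (m : lmm R) (n : nat) :
  admissible L a r m -> step_ratio m n.+1 = (n%:R + 2 + r) / (n%:R + 1 + r).
Proof.
move=> adm; have r1 := admissible_r adm.
case: adm => [[a0 h _] _].
rewrite /step_ratio /= !(h _).1.
have n0 := ler0n R n.
have p1 : 0 < n%:R + 1 + r by lra.
have := mulr_gt0 a0 p1 => ap1.
by field; apply/andP; split; apply: lt0r_neq0; lra.
Qed.

(** Here [b_n / w_{n+1} = n / (n + 2 + r)], so the consistency relation times [n + 2 + r] leaves the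
    constant [2 + r]. This eliminates [c_n] in favour of [D_n]. *)
Lemma admissible_coefc (R : realType) (L a r : R) (m : lmm R) (n : nat) :
  admissible L a r m -> (n%:R + 2 + r) * coefc m n = scaledD r m n + (2 + r).
Proof.
move=> adm; have r1 := admissible_r adm.
have n0 := ler0n R n.
rewrite /scaledD; case: (adm) => [[a0 _ hb] [/(_ n) [_ ->] _ _ _]].
rewrite (admissible_step_ratio _ adm) hb /linear_xi.
by field; apply/andP; split; apply: lt0r_neq0; lra.
Qed.

Lemma admissible_lyapAS (R : realType) (L a r : R) (m : lmm R) (n : nat) :
  admissible L a r m ->
  lyapAS r (@linear_xi R) m n =
    a * ((n%:R + 1 + r) * (scaledD r m n + (2 + r))
         - (n%:R + 2 + r) * scaledD r m n.+1).
Proof.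
move=> adm; rewrite -(admissible_coefc _ adm).
case: (adm) => [[a0 h _] _].
by rewrite /lyapAS /scaledD !(h _).1 /linear_xi; ring.
Qed.

Lemma scaledD0 (R : realType) (L a r : R) (m : lmm R) :
  admissible L a r m -> scaledD r m 0 = 0.
Proof. by move=> [_ [_ _ _ [[_ d0 _] _]]]; rewrite /scaledD d0 mulr0. Qed.

(** The factor [w_{n+1} / (w_{n+1} - 1)] equals [n + 2 + r], so [D_n] is exactly the sequence that
    absolute stability sends to [dhat]. The test value [lambda = - L] is enough. *)
Lemma scaledD_cvg (R : realType) (L a r : R) (m : lmm R) :
  0 < L -> admissible L a r m -> cvgn (scaledD r m).
Proof.
move=> L0 adm; have r1 := admissible_r adm.
case: (adm) => [_ [_ _ /(_ (- L)) st _]].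
have [|mu [? [? [? [dhat [[_ _ _ _ hd] _]]]]]] := st (lexx _).
  by rewrite oppr_lt0.
apply/cvg_ex; exists dhat.
apply: cvg_trans hd; apply: near_eq_cvg; near=> n.
have n0 := ler0n R n.
rewrite /scaledD (admissible_step_ratio _ adm); congr (_ * _).
by field; apply/andP; split; apply: lt0r_neq0; lra.
Unshelve. all: by end_near. Qed.

(** After division by [n + 1], the two [D] terms of [admissible_lyapAS] have the same limit and
    cancel. The shift to [n.+1] avoids dividing by 0. *)
Lemma lyapAS_cvg (R : realType) (L a r : R) (m : lmm R) :
  0 < L -> admissible L a r m ->
  (fun n => lyapAS r (@linear_xi R) m n.+1 / n.+1%:R) @ \oo --> a * (2 + r).
Proof.
move=> L0 adm; have /cvg_ex[d Dd] := scaledD_cvg L0 adm.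
have D1 : scaledD r m n.+1 @[n --> \oo] --> d by rewrite cvg_shiftS.
have D2 : scaledD r m n.+2 @[n --> \oo] --> d.
  by rewrite (cvg_shiftS (fun n => scaledD r m n.+1)).
have -> : a * (2 + r) = a * (1 * (d + (2 + r)) - 1 * d) by ring.
rewrite (_ : (fun n => _) = (fun n => a * ((1 + (1 + r) * harmonic n) *
  (scaledD r m n.+1 + (2 + r)) - (1 + (2 + r) * harmonic n) * scaledD r m n.+2))).
  apply: cvgMr; apply: cvgB; apply: cvgM => //; try exact: cvg_affine_harmonic.
  by apply: cvgD => //; exact: cvg_cst.
apply/funext => n /=; rewrite (admissible_lyapAS _ adm).
by field; rewrite addrC natr1 pnatr_eq0.
Qed.

Lemma rate_slope_gt0 (R : realType) (L a r : R) (m : lmm R) :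
  admissible L a r m -> 0 < a * (2 + r).
Proof.
move=> adm; have r1 := admissible_r adm.
by case: adm => [[a0 _ _] _]; rewrite mulr_gt0 //; lra.
Qed.

Lemma rate_seq_cvg (R : realType) (L a r : R) (m : lmm R) :
  0 < L -> admissible L a r m ->
  rate_seq r m @ \oo --> r ^+ 2 / (a * (2 + r)).
Proof.
move=> L0 adm; rewrite -cvg_shiftS.
rewrite (_ : (fun n => _) = (fun n => r ^+ 2 *
   (lyapAS r (@linear_xi R) m n.+1 / n.+1%:R)^-1)); last first.
  apply/funext => n; rewrite /rate_seq /lyapB /linear_xi.
  rewrite !invfM invrK expr2.
  have n0 : n.+1%:R != 0 :> R by rewrite pnatr_eq0.
  by move: (_ m n.+1)^-1 => v; field; rewrite addrC natr1.
apply: cvgMr; apply: cvgV; last exact: lyapAS_cvg L0 adm.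
exact/lt0r_neq0/(rate_slope_gt0 adm).
Qed.

(** * Constraints on [r] and [a] from the Lyapunov conditions *)

Lemma lyapAS_gt0 (R : realType) (L a r : R) (m : lmm R) (n : nat) :
  0 < L -> admissible L a r m -> 0 < lyapAS r (@linear_xi R) m n.+1.
Proof.
move=> L0 adm.
case: (adm) => [_ [_ _ _ [[_ _ lyap] _]]].
have A0 k : 0 <= lyapAS r (@linear_xi R) m k.+1.
  by have [+ _ _ _] := lyap k.+1; rewrite /lyapB /linear_xi pmulr_lge0.
rewrite lt_def A0 andbT; apply/negP => /eqP An0.
(* Vanishing propagates: if [A] is 0 at one index, the third condition makes the next [B]
   nonpositive, so the next [A] is 0 too. This contradicts the positive limit of [A_{n+1} / n]. *)
have Az k : lyapAS r (@linear_xi R) m (n + k).+1 = 0.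
  elim: k => [|k IH]; first by rewrite addn0.
  apply/eqP; rewrite eq_le addnS A0 andbT.
  have [_ _ + _] := lyap (n + k).+1.
  by rewrite /lyapB IH mul0r mulr0 !subr0 /linear_xi pmulr_lle0.
have [N _ /(_ (n + N)%N) /= ] :=
  cvgr_gt _ (lyapAS_cvg L0 adm) _ (rate_slope_gt0 adm).
by rewrite leq_addl Az mul0r ltxx => /(_ isT).
Qed.

(* If r < 2, the third Lyapunov condition makes A_{n+1} / n, whose limit is
   positive, decrease by at least a constant over n at each step. *)
Lemma admissible_r_ge2 (R : realType) (L a r : R) (m : lmm R) :
  0 < L -> admissible L a r m -> 2 <= r.
Proof.
move=> L0 adm; rewrite leNgt; apply/negP => r2.
have l0 := rate_slope_gt0 adm.
set l := a * (2 + r) in l0.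
pose q n := lyapAS r (@linear_xi R) m n.+1 / n.+1%:R.
have [N _ qN] : \forall n \near \oo, l / 2 < q n.
  by apply: (cvgr_gt _ (lyapAS_cvg L0 adm)); rewrite -/l; lra.
have e0 : 0 < 2 - r by lra.
(* The constant combines [q n > l / 2] with [(x + 1)^2 / 4 <= x^2] for [x >= 1]. *)
apply: (@harmonic_descent _ q (l * (2 - r) / 8) N).
- by rewrite divr_gt0 // mulr_gt0.
- by move=> n _; rewrite ltW // divr_gt0 // (lyapAS_gt0 _ L0 adm).
move=> n Nn; have := qN n Nn; move=> ql.
case: (adm) => [_ [_ _ _ [[_ _ lyap] _]]].
have [_ _ + _] := lyap n.+1.
have qE k : lyapAS r (@linear_xi R) m k.+1 = k.+1%:R * q k.
  by rewrite mulrC divfK // pnatr_eq0.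
rewrite /lyapB !qE /linear_xi.
have <- : n.+1%:R + 1 = n.+2%:R :> R by rewrite natr1.
set x : R := n.+1%:R; have x1 : 1 <= x by rewrite ler1n.
set q0 := q n in ql *; set q1 := q n.+1 => H.
have H1 : q1 * (x + 1) ^+ 2 <= q0 * (x * (x + r)).
  by rewrite expr2; lra.
have x10 : 0 < (x + 1) ^+ 2 by apply: exprn_gt0; lra.
have : q1 <= q0 * (x * (x + r)) / (x + 1) ^+ 2 by rewrite ler_pdivlMr.
have -> : q0 * (x * (x + r)) / (x + 1) ^+ 2 =
  q0 - q0 * ((2 - r) * x + 1) / (x + 1) ^+ 2.
  by field; apply: lt0r_neq0; lra.
move=> H2.
suff : l * (2 - r) / 8 / x <= q0 * ((2 - r) * x + 1) / (x + 1) ^+ 2.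
  by move=> /le_trans; apply; rewrite lerBrDr addrC -lerBrDr.
have x0 : 0 < x by lra.
rewrite ler_pdivrMr // [leRHS]mulrAC ler_pdivlMr //.
have q00 : 0 < q0 by lra.
have -> : l * (2 - r) / 8 * (x + 1) ^+ 2 = (2 - r) * (l / 2) * ((x + 1) / 2) ^+ 2.
  by field.
apply: (@le_trans _ _ ((2 - r) * q0 * x ^+ 2)).
  apply: ler_pM.
  - by apply: ltW; apply: mulr_gt0; lra.
  - exact: sqr_ge0.
  - by rewrite ler_pM2l // ltW.
  - by rewrite ler_sqr ?nnegrE; lra.
have : 0 <= q0 * x by rewrite mulr_ge0 // ltW.
by lra.
Qed.

(** The fourth condition at index [n + 1]: since [B_{n+1} = (n + 1) A_{n+2}] with [A_{n+2} > 0], the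
    factor [A_{n+2}] cancels in the quotient. *)
Lemma lyapunov_scaledD (R : realType) (L a r : R) (m : lmm R) (n : nat) :
  0 < L -> admissible L a r m ->
  lyapAS r (@linear_xi R) m n.+1 / 2 - r / (2 * L)
    - a * ((n%:R + 2 + r) * scaledD r m n.+1)
    + a ^+ 2 * L * ((n%:R + 2 + r) * scaledD r m n.+1) ^+ 2
      / (2 * n.+1%:R) <= 0.
Proof.
move=> L0 adm; have := lyapAS_gt0 n L0 adm.
case: (adm) => [[_ hs _] [_ _ _ [[_ _ lyap] _]]].
have [_ _ _] := lyap n.+1.
rewrite /lyapB /scaledD !(hs _).1 /linear_xi; set A := lyapAS _ _ _ _ => H A0.
move: H; congr (_ <= _); field.
by rewrite addrC natr1 pnatr_eq0 !lt0r_neq0.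
Qed.

Lemma admissible_step_bound (R : realType) (L a r : R) (m : lmm R) :
  0 < L -> admissible L a r m -> a * L * (2 + r) <= 1.
Proof.
move=> L0 adm; have r1 := admissible_r adm.
have a0 : 0 < a by case: adm => [[]].
have /cvg_ex[d Dd] := scaledD_cvg L0 adm.
have D1 : scaledD r m n.+1 @[n --> \oo] --> d by rewrite cvg_shiftS.
(* This is the left-hand side of [lyapunov_scaledD] divided by [n + 1], using [(n + 2 + r) / (n + 1)
   = 1 + (1 + r) * harmonic n]. *)
have lim : lyapAS r (@linear_xi R) m n.+1 / n.+1%:R * 2^-1
   - r / (2 * L) * harmonic n
   - a * ((1 + (1 + r) * harmonic n) * scaledD r m n.+1)
   + a ^+ 2 * L / 2 * (((1 + (1 + r) * harmonic n) * scaledD r m n.+1) *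
       ((1 + (1 + r) * harmonic n) * scaledD r m n.+1)) @[n --> \oo] -->
   a * (2 + r) * 2^-1 - r / (2 * L) * 0 - a * d
   + a ^+ 2 * L / 2 * (d * d).
  have GD : (1 + (1 + r) * harmonic n) * scaledD r m n.+1 @[n --> \oo]
      --> d.
    by rewrite -[X in _ --> X]mul1r; apply: cvgM => //; exact: cvg_affine_harmonic.
  apply: cvgD; last by apply: cvgMr; apply: cvgM.
  apply: cvgB; last exact: cvgMr.
  apply: cvgB; last by apply: cvgMr; exact: cvg_harmonic.
  by apply: cvgMl; exact: lyapAS_cvg L0 adm.
have le0 : a * (2 + r) * 2^-1 - r / (2 * L) * 0 - a * d
   + a ^+ 2 * L / 2 * (d * d) <= 0.
  apply: (cvgr_to_le lim); near=> n.
  have n0 : n.+1%:R != 0 :> R by rewrite pnatr_eq0.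
  have := lyapunov_scaledD n L0 adm.
  rewrite -(@pmulr_lle0 _ n.+1%:R^-1) ?invr_gt0 //=.
  by congr (_ <= _); field; rewrite addrC natr1 n0 lt0r_neq0.
have H : a * ((2 + r) - 2 * d + a * L * d ^+ 2) <= 0.
  by move: le0; rewrite -(@pmulr_rle0 _ 2) //; congr (_ <= _); field; rewrite lt0r_neq0.
rewrite pmulr_rle0 // in H.
(* Completing the square: [a L] times the bracket in [H] is [(a L d - 1)^2 + a L (2 + r) - 1]. *)
have : 0 <= (a * L * d - 1) ^+ 2 by exact: sqr_ge0.
have : a * L * ((2 + r) - 2 * d + a * L * d ^+ 2) <= 0 by rewrite pmulr_rle0 // mulr_gt0.
by lra.
Unshelve. all: by end_near. Qed.

(** * Uniqueness of [D_n] at the optimal [r] and [a] *)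

(* With e_n = (n + 3) D_n / 4 - n, the last Lyapunov condition reads
   e_{n+1} >= e_n + e_n^2 / n, so once e_n is positive, 1 / e_n decreases by at
   least 1 / (n + e_n) at each step, where n + e_n = O(n) as D_n converges. *)
Lemma optimal_scaledD (R : realType) (L : R) (m : lmm R) (n : nat) :
  0 < L -> admissible L (1 / (4 * L)) 2 m ->
  (n%:R + 3) * scaledD 2 m n = 4 * n%:R.
Proof.
move=> L0 adm.
have LN0 : L != 0 by exact: lt0r_neq0.
pose e k : R := (k%:R + 3) * scaledD 2 m k / 4 - k%:R.
suff ez : forall k, e k.+1 = 0.
  case: n => [|n]; first by rewrite (scaledD0 adm) !mulr0.
  by have := ez n; rewrite /e; lra.
have AE k : lyapAS 2 (@linear_xi R) m k = (k%:R + 2 + e k - e k.+1) / L.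
  rewrite (admissible_lyapAS _ adm) /e; field.
  exact: LN0.
have step_e k : e k.+1 * (k.+1%:R + e k.+1) <= e k.+2 * k.+1%:R.
  have := lyapunov_scaledD k L0 adm; rewrite AE.
  have -> : (k%:R + 2 + 2) * scaledD 2 m k.+1 = 4 * (k.+1%:R + e k.+1).
    by rewrite /e; field.
  set x : R := k.+1%:R.
  have x0 : 0 < x by rewrite ltr0n.
  rewrite -(@pmulr_rle0 _ (2 * x * L)) ?mulr_gt0 // => H.
  rewrite -subr_le0; move: H; congr (_ <= _); field.
  by rewrite LN0 lt0r_neq0.
(* The induction starts from the fourth condition at index 0: there [d_0 = 0] removes the last two
   terms, and [e_0 = 0] leaves [- e_1 <= 0]. *)
have e1 : 0 <= e 1%N.
  case: (adm) => [_ [_ _ _ [[_ d0 /(_ 0%N) [_ _ _ H4]] _]]].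
  move: H4; rewrite d0 expr0n /= !mulr0 !mul0r AE /e (scaledD0 adm).
  rewrite -(@pmulr_rle0 _ (2 * L)) ?mulr_gt0 // => H.
  rewrite -oppr_le0; move: H; congr (_ <= _); field.
  by rewrite LN0.
have e_ge0 k : 0 <= e k.+1.
  elim: k => // k IH; rewrite -(@pmulr_lge0 _ k.+1%:R) //.
  by apply: le_trans (step_e k); rewrite mulr_ge0 // addr_ge0.
move=> k; apply/eqP; rewrite eq_le e_ge0 andbT leNgt; apply/negP => ek.
have e_gt0 j : 0 < e (k + j).+1.
  elim: j => [|j IH]; first by rewrite addn0.
  rewrite addnS -(@pmulr_lgt0 _ (k + j).+1%:R) //.
  by apply: lt_le_trans (step_e _); rewrite mulr_gt0 // addr_gt0.
have /cvg_ex[d Dd] := scaledD_cvg L0 adm.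
have [N _ DN] := cvgr_le _ Dd (`|d| + 1) (le_lt_trans (ler_norm d) (ltr_pwDr ltr01 (lexx _))).
set K := `|d| + 1 in DN.
have K0 : 0 < K by rewrite ltr_wpDl.
have e_gt0' n' : (k + N < n')%N -> 0 < e n'.
  case: n' => // n'; rewrite ltnS => kn'.
  by rewrite -(subnKC (leq_trans (leq_addr N k) kn')).
apply: (@harmonic_descent _ (fun j => (e j)^-1) K^-1 (k + N).+1).
- by rewrite invr_gt0.
- by move=> n' /e_gt0'; rewrite invr_ge0; exact: ltW.
case=> // j kj; rewrite /=.
have p0 := e_gt0' _ kj.
have p1 := e_gt0' _ (ltnW kj : (k + N < j.+2)%N).
have x0 : 0 < j.+1%:R :> R by rewrite ltr0n.
have H := step_e j.
(* The left side is [(j + 4) D_{j+1} / 4]. The bound is stated with [j.+2] to match the denominator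
   in [harmonic_descent] at index [j.+1]. *)
have B : j.+1%:R + e j.+1 <= K * (j.+2%:R).
  have /DN /= DK : (N <= j.+1)%N by apply: leq_trans (ltnW kj); exact: leq_addl.
  have : (j%:R + 4) * scaledD 2 m j.+1 <= (j%:R + 4) * K by rewrite ler_pM2l.
  have : 0 <= K * j%:R by rewrite mulr_ge0 // ltW.
  by rewrite /e; lra.
move: H B p0 p1 x0; set x : R := j.+1%:R; set y : R := j.+2%:R.
have y0 : 0 < y by rewrite ltr0n.
set p := e j.+1; set q := e j.+2 => H B p0 p1 x0.
have s0 : 0 < x + p by rewrite addr_gt0.
(* The right side is [1 / p - 1 / (x + p)], so the reciprocal drops by at least [1 / (x + p)]. *)
have qI : q^-1 <= x / (p * (x + p)).
  by rewrite ler_pdivlMr ?mulr_gt0 // mulrC ler_pdivrMr // [x * q]mulrC.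
have : K^-1 / y <= (x + p)^-1.
  by rewrite -invfM lef_pV2 ?posrE // mulr_gt0.
move=> /le_trans; apply.
rewrite lerBrDr -lerBrDl; apply: (le_trans qI).
by rewrite le_eqVlt; apply/orP; left; apply/eqP; field; rewrite nat1r !lt0r_neq0.
Qed.

(** * Admissibility of the NAG-c parameters *)

Definition nag_lmm (R : realType) (L : R) : lmm R := Lmm
  (fun n => 1 / (4 * L) * n%:R + (1 + 2) * (1 / (4 * L)))
  (fun n => - (n%:R / (n%:R + 3)) - 1)
  (fun n => n%:R / (n%:R + 3))
  (fun n => (8 * n%:R + 12) / ((n%:R + 3) * (n%:R + 4)))
  (fun n => 4 * n%:R / ((n%:R + 3) * (n%:R + 4))).

(** The imaginary part of the equation is [2 y (x - s) = 0]. If [x = s], the real part gives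
    [|z|^2 = s]; if [y = 0], it reads [(x - s)^2 + s (1 - s) = 0], which forces [s = 0] and
    [z = 0]. *)
Lemma root_norm_lt1 (R : realType) (s : R) (z : R[i]) :
  0 <= s < 1 -> z ^+ 2 + (- (2 * s))%:C%C * z + s%:C%C = 0 -> `|z| < 1.
Proof.
move=> /andP[s0 s1]; case: z => x y /eqP; rewrite expr2 eq_complex /= => /andP[/eqP re /eqP im].
rewrite normc_def /= -[1]/(1%:C%C) ltcR -[ltRHS]sqrtr1 ltr_sqrt //.
have im' : y * (x - s) = 0 by move: im; lra.
move/eqP: im'; rewrite mulf_eq0 => /orP[/eqP y0|/eqP xs].
  have : (x - s) ^+ 2 + s * (1 - s) = 0 by move: re; rewrite y0; lra.
  have sge : 0 <= s * (1 - s) by rewrite mulr_ge0 //; lra.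
  have := sqr_ge0 (x - s) => sq /eqP; rewrite paddr_eq0 // => /andP[].
  rewrite sqrf_eq0 => /eqP xs.
  rewrite mulf_eq0 => /orP[/eqP ss|]; last by move=> /eqP; lra.
  have -> : x = 0 by lra.
  by rewrite y0 expr0n /= addr0.
suff -> : x ^+ 2 + y ^+ 2 = s by [].
have xE : x = s by lra.
by move: re; rewrite xE; lra.
Qed.

(** Splitting off the first term gives [S_n = 1 - b_n S_{n+1}], and this map preserves the interval
    [[0, 1]]. *)
Lemma alternating_sum_bound (R : realDomainType) (b : nat -> R) (n l : nat) :
  (forall i, 0 <= b i <= 1) ->
  0 <= \sum_(n <= j < (n + l).+1) \prod_(n <= i < j) (- b i) <= 1.
Proof.
move=> b01; elim: l n => [|l IH] n.
  by rewrite addn0 big_nat1 big_geq // ler01 lexx.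
rewrite big_ltn ?ltnS ?leq_addr // big_geq // addnS -addSn.
rewrite (eq_big_nat _ _ (F2 := fun j => - b n * \prod_(n.+1 <= i < j) (- b i))); last first.
  by move=> j /andP[nj _]; rewrite big_ltn.
rewrite -mulr_sumr; set S := \sum_(_ <= _ < _) _.
have /andP[S0 S1] : 0 <= S <= 1 by exact: IH.
have /andP[c0 c1] := b01 n.
have := mulr_ge0 c0 S0.
have : b n * S <= 1 * 1 by rewrite ler_pM.
by rewrite mulNr; lra.
Qed.

Lemma nag_step_ratio (R : realType) (L : R) (n : nat) :
  0 < L -> step_ratio (nag_lmm L) n.+1 = (n%:R + 4) / (n%:R + 3).
Proof.
move=> L0; have n0 := ler0n R n; rewrite /step_ratio /=.
by field; rewrite !lt0r_neq0 //; lra.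
Qed.

Lemma nag_step_ratio_scaling (R : realType) (L : R) (n : nat) : 0 < L ->
  step_ratio (nag_lmm L) n.+1 / (step_ratio (nag_lmm L) n.+1 - 1) = n%:R + 4.
Proof.
move=> L0; have n0 := ler0n R n; rewrite nag_step_ratio //.
by field; rewrite !lt0r_neq0 //; lra.
Qed.

Lemma nag_coefb_ge0_le1 (R : realType) (L : R) (n : nat) :
  0 <= coefb (nag_lmm L) n <= 1.
Proof.
have n0 := ler0n R n; have p : 0 < n%:R + 3 :> R by lra.
by rewrite /= divr_ge0 ?ler_pdivrMr ?mul1r ?ler_wpDr //=; lra.
Qed.

Lemma nag_lyapAS (R : realType) (L : R) (n : nat) :
  0 < L -> lyapAS 2 (@linear_xi R) (nag_lmm L) n = (n%:R + 2) / L.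
Proof.
move=> L0; have n0 := ler0n R n; rewrite /lyapAS /linear_xi /=.
by field; rewrite !lt0r_neq0 //; lra.
Qed.

Lemma nag_zero_stable (R : realType) (L : R) : zero_stable (nag_lmm L).
Proof.
exists 1 => // n l; split.
  rewrite normr_prod; apply: prodr_ile1 => i _.
  by have /andP[b0 b1] := nag_coefb_ge0_le1 L i; rewrite normr_ge0 ger0_norm.
have /andP[s0 s1] := alternating_sum_bound n l (nag_coefb_ge0_le1 L).
by rewrite ger0_norm.
Qed.

Lemma nag_absolutely_stable (R : realType) (L : R) :
  0 < L -> absolutely_stable L (nag_lmm L).
Proof.
move=> L0 lambda lL l0.
have nz (n k : nat) : n%:R + k.+1%:R != 0 :> R by rewrite -natrD addnS pnatr_eq0.
(* The last two limits come from [w / (w - 1) = n + 4], which turns [c_n] and [d_n] into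
   [(8 n + 12) / (n + 3)] and [4 n / (n + 3)]. *)
exists (lambda / (4 * L)), (-2), 1, 8, 4; split.
  split.
  - rewrite (_ : (fun n => _) = (fun=> lambda / (4 * L))); first exact: cvg_cst.
    by apply/funext => n /=; field; rewrite lt0r_neq0.
  - apply: (@cvg_homographic _ _ _ 3 2) => n /=; by  field; exact: (nz n 2%N).
  - apply: (@cvg_homographic _ _ _ (-3) 2) => n /=; by  field; exact: (nz n 2%N).
  - apply: (@cvg_homographic _ _ _ (-12) 2) => n /=; rewrite nag_step_ratio_scaling //=.
    by field; rewrite (nz n 2%N) (nz n 3%N).
  - apply: (@cvg_homographic _ _ _ (-12) 2) => n /=; rewrite nag_step_ratio_scaling //=.
    by field; rewrite (nz n 2%N) (nz n 3%N).
(* With these limits the characteristic polynomial is [z^2 - 2 s z + s]. *)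
pose s := 1 + lambda / L.
have s01 : 0 <= s < 1.
  rewrite /s; apply/andP; split.
    have : -1 <= lambda / L by rewrite ler_pdivlMr // mulN1r.
    by lra.
  have : lambda / L < 0 by rewrite pmulr_llt0 ?invr_gt0.
  by lra.
move=> z zE; apply: (root_norm_lt1 s01).
rewrite -[RHS]zE; congr (_ + _%:C%C * _ + _%:C%C).
  by rewrite /s; field; exact: lt0r_neq0.
by rewrite /s; field; exact: lt0r_neq0.
Qed.

(** Here [B_n = n (n + 2) / L]. The third condition has constant slack [1 / L], and the fourth is an
    equality at every index. *)
Lemma nag_lyapunov_rate (R : realType) (L : R) :
  0 < L -> lyapunov_rate L 2 (@linear_xi R) (nag_lmm L).
Proof.
move=> L0; have LI0 : 0 < L^-1 by rewrite invr_gt0.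
have Ln0 : L != 0 by exact: lt0r_neq0.
split.
  split=> [||n] //=; first by rewrite mulr0 mul0r.
  have n0 := ler0n R n.
  rewrite /lyapB !nag_lyapAS // /linear_xi; split.
  - by rewrite !mulr_ge0 // ?ltW //; lra.
  - rewrite (_ : _ - _ = (2 * n%:R + 3) / L); last by field.
    by rewrite mulr_ge0 // ?ltW //; lra.
  - rewrite (_ : _ - _ = - L^-1); last by field.
    by rewrite oppr_le0 ltW.
  - case: n n0 => [|n] n0 /=.
      by rewrite !(mulr0, mul0r, expr0n) /=; rewrite le_eqVlt; apply/orP; left; apply/eqP; field.
    have n1 : 0 < n.+1%:R :> R by [].
    rewrite le_eqVlt; apply/orP; left; apply/eqP; field.
    by rewrite Ln0 /=; rewrite !lt0r_neq0 //; lra.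
(* For [n >= 1], [n^2 <= n (n + 2) <= 3 n^2]. *)
rewrite qualifE; apply/asboolP; exists (L^-1, 3 / L) => /=.
  by rewrite LI0 divr_gt0.
near=> n.
have n1 : 1 <= n%:R :> R by rewrite ler1n; near: n; exact: nbhs_infty_ge.
rewrite /lyapB nag_lyapAS // /linear_xi !ger0_norm ?sqr_ge0 //; last first.
  by rewrite !mulr_ge0 // ?ltW //; lra.
have nn : 0 <= n%:R * (n%:R - 1) :> R by rewrite mulr_ge0; lra.
split.
  by rewrite -[leRHS]mulrA [leRHS]mulrC -[leRHS]mulrA ler_pM2l //; lra.
rewrite -[leLHS]mulrA [leLHS]mulrC (mulrC 3) -!mulrA ler_pM2l //; lra.
Unshelve. all: by end_near. Qed.

Lemma nag_admissible (R : realType) (L : R) :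
  0 < L -> admissible L (1 / (4 * L)) 2 (nag_lmm L).
Proof.
move=> L0; split; split.
- by rewrite divr_gt0 // mulr_gt0.
- move=> n; split=> //=.
  have p : 0 < 1 / (4 * L) by rewrite divr_gt0 // mulr_gt0.
  by have := mulr_ge0 (ltW p) (ler0n R n); lra.
- by move=> n; rewrite /linear_xi /=; congr (_ / _); ring.
- move=> n; split=> //; rewrite nag_step_ratio //=.
  have n0 := ler0n R n.
  by field; rewrite !lt0r_neq0 //; lra.
- exact: nag_zero_stable.
- exact: nag_absolutely_stable.
- exact: nag_lyapunov_rate.
Qed.

(** * The multistep recursion rewritten as the NAG-c iteration *)

Lemma nag_iteration_step (R : realType) (L : R) (V : lmodType R) (n : nat)
    (x0 x1 x2 f0 f1 : V) : 0 < L ->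
  x2 + coefa (nag_lmm L) n *: x1 + coefb (nag_lmm L) n *: x0 =
    step (nag_lmm L) n.+1 *:
      (coefc (nag_lmm L) n *: (- f1) - coefd (nag_lmm L) n *: (- f0)) <->
  x2 = (x1 - (1 / L) *: f1) + (n%:R / (n%:R + 3)) *:
         ((x1 - (1 / L) *: f1) - (x0 - (1 / L) *: f0)).
Proof.
move=> L0; have n0 := ler0n R n; rewrite /=.
set b := n%:R / (n%:R + 3).
rewrite !scalerN opprK scalerDr scalerN !scalerA.
set h := 1 / (4 * L) * n.+1%:R + _.
(* The gradient weights are [h_{n+1} c_n = (1 + b_n) / L] and [h_{n+1} d_n = b_n / L], those of the
   momentum step with [y] eliminated. *)
have -> : h * ((8 * n%:R + 12) / ((n%:R + 3) * (n%:R + 4))) = 1 / L + b * (1 / L).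
  by rewrite /h /b; field; rewrite !lt0r_neq0 //; lra.
have -> : h * (4 * n%:R / ((n%:R + 3) * (n%:R + 4))) = b * (1 / L).
  by rewrite /h /b; field; rewrite !lt0r_neq0 //; lra.
rewrite [_ *: (_ - _ - _)]scalerBr !scalerBr scalerA 2!scalerDl !scaleN1r scaleNr.
rewrite -[x2 + _ + _]addrA.
set lhs := _ - x1 + _; set rhs := _ + _ *: f0; set nag := x1 - _ + _.
have -> : nag = rhs - lhs.
  rewrite /nag /rhs /lhs scalerA !opprD !opprK.
  by rewrite [RHS](AC (3*3) ((5*1)*((4*2)*(6*3)))).
by split=> [<-|->]; [rewrite addrK|rewrite subrK].
Qed.

Lemma nag_iteration (R : realType) (L : R) (V : lmodType R) (df : V -> V)
    (x : nat -> V) : 0 < L ->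
  lmm_iteration (nag_lmm L) (fun z => - df z) x <->
  exists y : nat -> V, nag_c (1 / L) df x y.
Proof.
move=> L0; split=> [it|[y nag] n].
  (* At [n = 0] the momentum factor is [- 1 / 2], so [x_1 = (y_1 + y_0) / 2]; this dictates
     [y_0 = 2 x_1 - y_1]. *)
  pose y n := if n is k.+1 then x k - (1 / L) *: df (x k)
    else 2 *: x 1%N - (x 0%N - (1 / L) *: df (x 0%N)).
  exists y => -[|n]; split=> //.
    rewrite /y; set y1 := x 0%N - _.
    have -> : (0%:R - 1) / (0%:R + 2) = - 2^-1 :> R by field.
    rewrite opprB addrA -mulr2n -[y1 *+ 2]scaler_nat -scalerBr scalerA mulNr mulVf //.
    by rewrite scaleN1r opprB addrC subrK.
  have /(nag_iteration_step _ _ _ _ _ _ L0) -> := it n.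
  by rewrite /y; congr (_ + _ *: _); rewrite -natr1; congr (_ / _); ring.
apply/(nag_iteration_step _ _ _ _ _ _ L0).
have [_ ->] := nag n.+1; have [-> _] := nag n.+1; have [-> _] := nag n.
by congr (_ + _ *: _); rewrite -natr1; congr (_ / _); ring.
Qed.

(** * The minimal coefficient and uniqueness of the minimizer *)

Lemma lmm_eq_nag (R : realType) (L : R) (m : lmm R) :
  (forall n : nat,
    [/\ step m n = 1 / (4 * L) * n%:R + (1 + 2) * (1 / (4 * L)),
        coefa m n = - coefb m n - 1,
        coefb m n = n%:R / (n%:R + 3),
        coefc m n = (8 * n%:R + 12) / ((n%:R + 3) * (n%:R + 4))
      & coefd m n = 4 * n%:R / ((n%:R + 3) * (n%:R + 4))]) ->
  m = nag_lmm L.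
Proof.
case: m => h ca cb cc cd /= E.
by rewrite /nag_lmm; congr Lmm; apply/funext => n; have [e1 e2 e3 e4 e5] := E n;
  rewrite ?e1 ?e2 ?e3 ?e4 ?e5.
Qed.

Lemma rate_lower_bound (R : realType) (L a r : R) (m : lmm R) :
  0 < L -> admissible L a r m -> L * r ^+ 2 <= r ^+ 2 / (a * (2 + r)).
Proof.
move=> L0 adm; have := admissible_step_bound L0 adm.
rewrite ler_pdivlMr; last exact: rate_slope_gt0 adm.
move=> H; have := sqr_ge0 r => r2; have := ler_wpM2l r2 H; lra.
Qed.

Lemma limn_rate_seq (R : realType) (L a r : R) (m : lmm R) :
  0 < L -> admissible L a r m ->
  limn (rate_seq r m) = r ^+ 2 / (a * (2 + r)).
Proof. by move=> L0 adm; apply: cvg_lim => //; exact: rate_seq_cvg L0 adm. Qed.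

Lemma nag_minimizer (R : realType) (L : R) :
  0 < L -> minimizer L (1 / (4 * L)) 2 (nag_lmm L).
Proof.
move=> L0; have nagadm := nag_admissible L0; split=> // a r m adm.
rewrite (limn_rate_seq L0 nagadm) (limn_rate_seq L0 adm).
apply: le_trans (rate_lower_bound L0 adm).
have -> : 2 ^+ 2 / (1 / (4 * L) * (2 + 2)) = L * 2 ^+ 2.
  by field; exact: lt0r_neq0.
have r2 := admissible_r_ge2 L0 adm.
by rewrite ler_pM2l // ler_sqr ?nnegrE //; lra.
Qed.

Lemma minimizer_is_nag (R : realType) (L a r : R) (m : lmm R) :
  0 < L -> minimizer L a r m ->
  [/\ r = 2, a = 1 / (4 * L) & m = nag_lmm L].
Proof.
move=> L0 [adm /(_ _ _ _ (nag_admissible L0))].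
rewrite (limn_rate_seq L0 adm) (limn_rate_seq L0 (nag_admissible L0)).
have -> : 2 ^+ 2 / (1 / (4 * L) * (2 + 2)) = L * 2 ^+ 2.
  by field; exact: lt0r_neq0.
(* The coefficient lies between [L r^2] and the NAG-c value [4 L], so [r >= 2] forces [r = 2]; the
   value [4 L] then gives [4 a L >= 1], the reverse of the step bound. *)
move=> le4L; have le := rate_lower_bound L0 adm.
have r_ge2 := admissible_r_ge2 L0 adm.
have r2 : r = 2.
  apply/eqP; rewrite eq_le r_ge2 andbT.
  have := le_trans le le4L; rewrite ler_pM2l // ler_sqr ?nnegrE //; lra.
have aE : a = 1 / (4 * L).
  have := admissible_step_bound L0 adm.
  have := rate_slope_gt0 adm; rewrite r2 => slope.
  move: le4L; rewrite r2 ler_pdivrMr //.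
  move=> H1 H2; have H : a * L * 4 = 1 by lra.
  by apply: (mulIf (lt0r_neq0 (mulr_gt0 (ltr0n R 4) L0))); rewrite divfK; lra.
rewrite r2 aE in adm *; split=> //; apply: lmm_eq_nag => n.
have n0 := ler0n R n.
case: (adm) => [[_ hs hb] [/(_ n) [ha _] _ _ _]].
(* For [r = 2] the left side is [D_n], determined by [optimal_scaledD]; consistency then recovers
   [c_n]. *)
have D : (n%:R + 4) * coefd m n = 4 * n%:R / (n%:R + 3).
  apply: (@mulfI _ (n%:R + 3)); first by apply: lt0r_neq0; lra.
  rewrite [RHS]mulrC divfK; last by apply: lt0r_neq0; lra.
  rewrite -(optimal_scaledD n L0 adm) /scaledD; ring.
have n4 : n%:R + 4 != 0 :> R by apply: lt0r_neq0; lra.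
have n3 : n%:R + 3 != 0 :> R by apply: lt0r_neq0; lra.
split=> //.
- by rewrite (hs n).1; ring.
- by rewrite hb /linear_xi; congr (_ / _); ring.
- apply: (mulfI n4); have := admissible_coefc n adm.
  rewrite -[n%:R + 2 + 2]addrA /scaledD -[n%:R + 2 + 2]addrA.
  have -> : 2 + 2 = 4 :> R by ring.
  move=> ->; rewrite D; field; rewrite ?n3 ?n4 //.
- by apply: (mulfI n4); rewrite D; field; rewrite n3 n4.
Qed.

Theorem theorem4p1 (R : realType) (L : R) (L_gt0 : 0 < L) :
  [/\ (* the coefficient of 1/n^2 exists for every admissible method *)
      forall (a r : R) (m : lmm R), admissible L a r m -> cvgn (rate_seq r m),
      (* the minimizing parameters *)
      forall (a r : R) (m : lmm R), minimizer L a r m <->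
        [/\ r = 2, a = 1 / (4 * L) &
        forall n : nat,
        [/\ step m n = a * n%:R + (1 + r) * a,
            coefa m n = - coefb m n - 1,
            coefb m n = n%:R / (n%:R + 3),
            coefc m n = (8 * n%:R + 12) / ((n%:R + 3) * (n%:R + 4))
          & coefd m n = 4 * n%:R / ((n%:R + 3) * (n%:R + 4))]]
    & (* and the resulting method is NAG-c with s = 1/L *)
      forall (a r : R) (m : lmm R), minimizer L a r m ->
      forall (V : lmodType R) (df : V -> V) (x : nat -> V),
        lmm_iteration m (fun z => - df z) x <->
        exists y : nat -> V, nag_c (1 / L) df x y].
Proof.
split=> [a r m adm|a r m|a r m /(minimizer_is_nag L_gt0) [_ _ ->] V df x].
- by apply/cvg_ex; exists (r ^+ 2 / (a * (2 + r))); exact: rate_seq_cvg adm.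
- split=> [/(minimizer_is_nag L_gt0) [-> -> ->] //|[-> -> mE]].
  by rewrite (lmm_eq_nag mE); exact: nag_minimizer.
- exact: nag_iteration.
Qed.
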